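(* Let $m\ge 0$ be an integer and let $F$ be an $m\times m$ rational matrix function. Then $F\in\mathcal{PRO}_m$ if and only if $F$ is of the form $$F(z) = z Q + R + \sum_{j=1}^s \frac{1}{z^2 + \omega_j^2} \left(zQ_j + R_j \right)$$ for some integer $s\ge 0$, real numbers $\omega_j\geq 0$ ($j=1,\dots,s$) and matrices $Q,R,Q_j,R_j\in \mathbb{R}^{m\times m}$ with $Q\ge 0$, $Q_j\geq 0$ and $R,R_j$ skew-symmetric ($j=1,\dots,s$), such that $$-\omega_j Q_j \leq i R_j \leq \omega_j Q_j,\qquad j=1,\ldots,s.$$
   Context: For a square matrix $K$, $\mathrm{Re}(K)=\frac12(K+K^* )$; $K\ge 0$ means $K$ is (Hermitian) positive semidefinite, and $K\ge L$ means $K-L\ge 0$. For an integer $m\ge 0$, $\mathcal{PRO}_m$ (positive real odd functions) denotes the class of $m\times m$ rational matrix functions $F$ such that (1) $\mathrm{Re}(F(z))\ge 0$ for $\mathrm{Re}(z)>0$; (2) $F(t)\in\mathbb{R}^{m\times m}$ for $t\in\mathbb{R}$ (not a pole of $F$); (3) $-F(z)=F(-\overline{z})^*$ for every $z$ that is not a pole of $F$. *)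

(* Defs.v *)
From mathcomp Require Import all_boot all_order all_algebra.
From mathcomp Require Import generic_quotient reals complex.

Set Implicit Arguments.
Unset Strict Implicit.
Unset Printing Implicit Defensive.

Import Order.TTheory GRing.Theory Num.Theory.
Local Open Scope ring_scope.
Local Open Scope sesquilinear_scope.

Notation "x %:F" := (FracField.tofrac x) (at level 1, format "x %:F").

Section RationalFunctions.
Variable K : fieldType.
Implicit Types (f : {fraction {poly K}}) (z : K).

(* Numerator and denominator in lowest terms (unique up to a nonzero scalar). *)
Definition ratnum f : {poly K} :=
  \n_(repr f) %/ gcdp \n_(repr f) \d_(repr f).
Definition ratden f : {poly K} :=
  \d_(repr f) %/ gcdp \n_(repr f) \d_(repr f).

Definition is_pole f z := root (ratden f) z.

(* Meaningful only when z is not a pole of f; it is 0 at a pole. *)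
Definition rateval f z : K := (ratnum f).[z] / (ratden f).[z].

Let repr_gcdp_neq0 f : gcdp \n_(repr f) \d_(repr f) != 0.
Proof. by rewrite gcdp_eq0 negb_and denom_ratioP orbT. Qed.

Lemma ratden_neq0 f : ratden f != 0.
Proof. by rewrite dvdp_div_eq0 ?dvdp_gcdr // denom_ratioP. Qed.

Lemma coprimep_ratnum_ratden f : coprimep (ratnum f) (ratden f).
Proof. by rewrite /ratnum /ratden coprimep_div_gcd // denom_ratioP orbT. Qed.

Lemma rat_numden f : f = (ratnum f)%:F / (ratden f)%:F.
Proof.
have fE : f = (\n_(repr f))%:F / (\d_(repr f))%:F.
  have d0 : (\d_(repr f))%:F != 0 :> {fraction {poly K}}.
    by rewrite tofrac_eq0 denom_ratioP.
  apply: (canRL (mulfK d0)); rewrite -[f in LHS]reprK.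
  unlock FracField.tofrac; rewrite -[LHS]FracField.pi_mul.
  apply/(@eqmodP _ (@FracField.equivf_equiv _)); rewrite /= FracField.equivfE /FracField.mulf reprK.
  by rewrite !numden_Ratio ?mulr1 ?oner_eq0 ?denom_ratioP // mulrC.
have g0 := repr_gcdp_neq0 f.
rewrite [LHS]fE.
rewrite -[X in X%:F / _](divpK (dvdp_gcdl _ \d_(repr f))).
rewrite -[X in _ / X%:F](divpK (dvdp_gcdr \n_(repr f) _)).
by rewrite !rmorphM /= -mulf_div divff ?mulr1 // tofrac_eq0.
Qed.

Lemma rat_fracP (p q : {poly K}) z : q.[z] != 0 ->
  ~~ is_pole (p%:F / q%:F) z /\ rateval (p%:F / q%:F) z = p.[z] / q.[z].
Proof.
move=> qz; pose f := p%:F / q%:F.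
have q0 : q != 0 by apply: contraNneq qz => ->; rewrite horner0.
have E : p * ratden f = ratnum f * q.
  apply/eqP; rewrite -tofrac_eq !rmorphM /= -eqr_div ?tofrac_eq0 ?ratden_neq0 //.
  by rewrite -rat_numden.
have Ez : p.[z] * (ratden f).[z] = (ratnum f).[z] * q.[z].
  by rewrite -!hornerM E.
have np : ~~ is_pole f z.
  apply/negP=> dz; have cop : coprimep (ratden f) (ratnum f).
    by rewrite coprimep_sym coprimep_ratnum_ratden.
  have := mulf_neq0 (coprimep_root cop dz) qz.
  by rewrite -Ez (rootP dz) mulr0 eqxx.
split=> //; rewrite /rateval; apply/eqP; rewrite eqr_div //.
by rewrite -Ez.
Qed.

End RationalFunctions.

Section RationalMatrixFunctions.
Variables (K : fieldType) (m : nat).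
Implicit Types (F : 'M[{fraction {poly K}}]_m) (z : K).

Definition is_mxpole F z := [exists i, exists j, is_pole (F i j) z].

Definition mxeval F z : 'M[K]_m := \matrix_(i, j) rateval (F i j) z.

End RationalMatrixFunctions.

Section Hermitian.
Variables (C : numClosedFieldType) (m : nat).
Implicit Types A B : 'M[C]_m.

Definition mxRe A : 'M[C]_m := 2^-1 *: (A + A^t*).

Definition mxpsd A : Prop :=
  A \is hermsymmx /\ forall u : 'cV[C]_m, 0 <= (u^t* *m A *m u) 0 0.

Definition mxle A B : Prop := mxpsd (B - A).

End Hermitian.

(* The first condition requires F to be defined on the whole open right
   half-plane, and the third requires F to be defined at the reflected point. *)
Definition PRO (R : realType) (m : nat)
    (F : 'M[{fraction {poly R[i]}}]_m) : Prop :=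
  [/\ forall z : R[i], 0 < 'Re z ->
        ~~ is_mxpole F z /\ mxpsd (mxRe (mxeval F z)),
      forall t : R[i], t \is Num.real -> ~~ is_mxpole F t ->
        mxeval F t \is a realmx
    & forall z : R[i], ~~ is_mxpole F z ->
        ~~ is_mxpole F (- z^*) /\ - mxeval F z = (mxeval F (- z^*))^t*].

Definition cplxmx (R : realType) (m : nat) (A : 'M[R]_m) : 'M[R[i]]_m :=
  map_mx (real_complex R) A.

Definition ratC (R : realType) (c : R[i]) : {fraction {poly R[i]}} := (c%:P)%:F.

Definition ratX (R : realType) : {fraction {poly R[i]}} := ('X)%:F.

Definition ratmx (R : realType) (m : nat) (A : 'M[R]_m) :
    'M[{fraction {poly R[i]}}]_m :=
  map_mx (@ratC R) (cplxmx A).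

(* Main.v *)
From HB Require Import structures.
Require Import Defs.
From mathcomp Require Import all_boot all_order all_algebra.
From mathcomp Require Import reals complex.
From mathcomp Require Import ring.

Import Order.TTheory GRing.Theory Num.Theory.
Local Open Scope ring_scope.

Set Implicit Arguments.
Unset Strict Implicit.
Unset Printing Implicit Defensive.

(** The theorem is a matrix version of Foster's reactance theorem: a positive
    real odd function is its own partial fraction expansion, all poles being
    simple, purely imaginary, and with positive semidefinite residues.

    From a positive real odd F to the expansion.  F has no pole in the open
    right half-plane by positivity, hence none in the open left one by oddness.
    For a vector u, the scalar function f = u^* F u has nonnegative real part on
    Re z > 0.  Near a pole a of order n with Re a = 0, f behaves like
    c (z - a)^-n; letting z tend to a along every ray of the half-plane gives
    Re (c w^n) >= 0 for all w with Re w > 0.  For n > 1 the powers w^n sweep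
    enough of the plane to force c = 0, and for n = 1 they force c >= 0
    ([power_half_plane_eq0], [linear_half_plane_ge0]).  The same argument at
    infinity shows that f grows at most like c z with c >= 0.  So f has a residue
    at a, and a coefficient at infinity, which are nonnegative for every u;
    polarization turns this into the existence of positive semidefinite
    coefficient matrices for F ([psd_coefficient]).  Subtracting the polar parts
    leaves a polynomial, which the growth bound makes affine:
    F = z Q + B + sum_a A_a / (z - a).

    Since F is real at positive reals, F is there the average of this expansion
    and of its complex conjugate.  Conjugation exchanges the poles a and -a, so
    averaging pairs A_a / (z - a) with conj A_a / (z + a), which for a = i w is
    (z Re A_a - w Im A_a) / (z^2 + w^2).  Hence every pole contributes one term
    with Q_j = Re A_a, R_j = - w Im A_a and omega_j = |w|, and the bounds
    between i R_j and omega_j Q_j say that |w| A_a and |w| conj A_a are positive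
    semidefinite.  Two rational functions that agree at the positive integers are
    equal, which gives the identity of fractions ([expansion_foster]).

    Conversely, positivity reduces to an inequality between real numbers for
    each term ([Re_elementary_ge0]).  Reality and oddness have to hold at every
    regular point of the sum, including points that are poles of individual
    terms, so they are proved as identities in the field of fractions: the
    expansion is fixed by conjugation of the coefficients, and is sent to minus
    its transpose when z is moreover replaced by -z ([conj_foster],
    [reflect_foster]). *)

(** * Values and partial fractions of rational functions *)

Definition constf (K : fieldType) : K -> {fraction {poly K}} :=
  @FracField.tofrac _ \o polyC.

HB.instance Definition _ (K : fieldType) :=
  GRing.RMorphism.copy (@constf K) (@FracField.tofrac _ \o polyC).

Section Values.
Variable K : fieldType.
Implicit Types (f g : {fraction {poly K}}) (z v w a c : K) (p q : {poly K}).

Definition has_value f z v := ~~ is_pole f z /\ rateval f z = v.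

Lemma ratio_value p q z : q.[z] != 0 -> has_value (p%:F / q%:F) z (p.[z] / q.[z]).
Proof. exact: rat_fracP. Qed.

Lemma has_valueP f z v : has_value f z v ->
  exists p q, [/\ f = p%:F / q%:F, q.[z] != 0 & v = p.[z] / q.[z]].
Proof.
by case=> fz <-; exists (ratnum f), (ratden f); split=> //; exact: rat_numden.
Qed.

Lemma value_unique f z v w : has_value f z v -> has_value f z w -> v = w.
Proof. by case=> _ <- [_ <-]. Qed.

Lemma value_poly p z : has_value p%:F z p.[z].
Proof.
have := @ratio_value p 1 z; rewrite hornerC oner_eq0 => /(_ isT).
by rewrite tofrac1 !divr1.
Qed.

Lemma value_const c z : has_value (constf c) z c.
Proof. by have := value_poly c%:P z; rewrite hornerC. Qed.

Lemma horner_neq0 q z : q.[z] != 0 -> q != 0.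
Proof. by apply: contra_neq => ->; rewrite horner0. Qed.

Lemma ratioD p q p' q' : q != 0 -> q' != 0 ->
  p%:F / q%:F + p'%:F / q'%:F = (p * q' + p' * q)%:F / (q * q')%:F.
Proof.
rewrite -(tofrac_eq0 q) -(tofrac_eq0 q') => q0 q0'.
by rewrite (addf_div _ _ q0 q0') tofracD !tofracM.
Qed.

Lemma ratioM p q p' q' :
  (p%:F / q%:F) * (p'%:F / q'%:F) = (p * p')%:F / (q * q')%:F.
Proof. by rewrite mulf_div !tofracM. Qed.

Lemma valueD f g z v w :
  has_value f z v -> has_value g z w -> has_value (f + g) z (v + w).
Proof.
move=> /has_valueP[p [q [-> qz ->]]] /has_valueP[p' [q' [-> qz' ->]]].
rewrite ratioD ?(horner_neq0 qz) ?(horner_neq0 qz') //.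
rewrite (addf_div _ _ qz qz') -!hornerM -hornerD; apply: ratio_value.
by rewrite hornerM mulf_neq0.
Qed.

Lemma valueM f g z v w :
  has_value f z v -> has_value g z w -> has_value (f * g) z (v * w).
Proof.
move=> /has_valueP[p [q [-> qz ->]]] /has_valueP[p' [q' [-> qz' ->]]].
rewrite ratioM (mulf_div p.[z]) -!hornerM; apply: ratio_value.
by rewrite hornerM mulf_neq0.
Qed.

Lemma valueN f z v : has_value f z v -> has_value (- f) z (- v).
Proof.
move=> fv; rewrite -mulN1r -[- v]mulN1r.
by have := valueM (value_const (- 1) z) fv; rewrite rmorphN1.
Qed.

Lemma valueV f z v : has_value f z v -> v != 0 -> has_value f^-1 z v^-1.
Proof.
move=> /has_valueP[p [q [-> qz ->]]] pq; rewrite !invf_div.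
apply: ratio_value; apply: contraNneq pq => ->; by rewrite mul0r.
Qed.

Lemma value_sum (I : Type) (r : seq I) (P : pred I) (f : I -> {fraction {poly K}}) z (v : I -> K) :
  (forall i, P i -> has_value (f i) z (v i)) ->
  has_value (\sum_(i <- r | P i) f i) z (\sum_(i <- r | P i) v i).
Proof.
move=> fv; apply: (big_rec2 (fun g w => has_value g z w)) => [|i g w Pi].
  by have := value_const 0 z; rewrite rmorph0.
by move=> gw; apply: valueD => //; exact: fv.
Qed.

(** The coefficient of 1 / (X - a) in a function whose pole at a is at most
    simple; the relation fails when the order of the pole exceeds one. *)
Definition residue f a v := has_value (('X - a%:P)%:F * f) a v.

Definition polar (r a : K) : {fraction {poly K}} := constf r / ('X - a%:P)%:F.

Lemma polar_value r a z : z != a -> has_value (polar r a) z (r / (z - a)).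
Proof.
move=> za; apply: valueM; first exact: value_const.
have := value_poly ('X - a%:P) z; rewrite hornerXsubC => /valueV; apply.
by rewrite subr_eq0.
Qed.

(** Write (X - a) f = p / q.  Then p - r q vanishes at a, which cancels the
    simple pole. *)
Lemma residue_sub_polar f a r : residue f a r ->
  exists v, has_value (f - polar r a) a v.
Proof.
move=> /has_valueP[p [q [E qz rE]]].
have /factor_theorem[p1 p1E] : root (p - r *: q) a.
  by rewrite rootE !hornerE rE divfK // subrr.
exists (p1.[a] / q.[a]).
suff -> : f - polar r a = p1%:F / q%:F by apply: ratio_value.
have field_identity (L : fieldType) (x g P Q P1 c : L) : x != 0 -> Q != 0 ->
    x * g = P / Q -> P - c * Q = P1 * x -> g - c / x = P1 / Q.
  move=> x0 Q0 gE PE; have -> : g = P / Q / x by rewrite -gE mulrC mulKf.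
  by rewrite -(subrK (c * Q) P) PE; field; rewrite ?x0 ?Q0.
apply: field_identity E _; rewrite ?tofrac_eq0 ?polyXsubC_eq0 ?(horner_neq0 qz) //.
by rewrite -tofracM -tofracM -p1E tofracB mul_polyC.
Qed.

End Values.

Section PartialFractions.
Variable C : numClosedFieldType.
Implicit Types (f g : {fraction {poly C}}).

(** Over an algebraically closed field a denominator without roots is constant. *)
Lemma regular_is_poly f : (forall z, ~~ is_pole f z) -> exists p, f = p%:F.
Proof.
move=> reg; have [/eqP/size_poly1P[c c0 dE]|/closed_rootP[z fz]] :=
  eqVneq (size (ratden f)) 1%N.
  exists (c^-1 *: ratnum f); rewrite [LHS]rat_numden dE -mul_polyC rmorphM /=.
  rewrite mulrC; congr (_ * _); apply: (mulfI (x := (c%:P)%:F)).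
    by rewrite tofrac_eq0 polyC_eq0.
  by rewrite divff ?tofrac_eq0 ?polyC_eq0 // -tofracM -polyCM divff ?tofrac1.
by have := reg z; rewrite /is_pole fz.
Qed.

(** After subtraction of all polar parts nothing singular remains, so the
    difference is a polynomial. *)
Lemma partial_fractions f (s : seq C) (r : C -> C) : uniq s ->
    {in s, forall a, residue f a (r a)} ->
    (forall z, z \notin s -> ~~ is_pole f z) ->
  exists p, f = p%:F + \sum_(a <- s) polar (r a) a.
Proof.
move=> us res reg.
have [z|p pE] := @regular_is_poly (f - \sum_(a <- s) polar (r a) a); last first.
  by exists p; rewrite -pE subrK.
suff [v []] : exists v, has_value (f - \sum_(a <- s) polar (r a) a) z v by [].
have reg_sum (t : seq C) : z \notin t ->
    has_value (- \sum_(a <- t) polar (r a) a) z (- \sum_(a <- t) (r a / (z - a))).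
  move=> zt; apply: valueN; rewrite !big_seq; apply: value_sum => a at_.
  by apply: polar_value; apply: contraNneq zt => ->.
have [zs|zs] := boolP (z \in s); last first.
  eexists; apply: valueD; last exact: reg_sum.
  by split; [exact: reg|].
rewrite (big_rem z) //= opprD addrA.
have [v vP] := residue_sub_polar (res z zs).
eexists; apply: valueD; first exact: vP.
by apply: reg_sum; rewrite mem_rem_uniqF.
Qed.

End PartialFractions.

(** * Functions with nonnegative real part on the right half-plane *)

Section HalfPlane.
Variable C : numClosedFieldType.
Implicit Types (a c v w z e : C) (p q : {poly C}) (f : {fraction {poly C}}).

(** Continuity at 0 from the right: p(e) = p(0) + e q(e) with q bounded on the
    unit disk, so a negative real part at 0 would persist for small e. *)
Lemma Re_horner0_ge0 p : (forall e, 0 < e -> 0 <= 'Re p.[e]) -> 0 <= 'Re p.[0].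
Proof.
move=> pos; rewrite real_leNgt ?Creal_Re ?rpred0 //; apply/negP => neg.
have /factor_theorem[q pE] : root (p - p.[0]%:P) 0.
  by rewrite rootE !hornerE subrr.
have [M qM] := poly_disk_bound q 1.
have M0 : 0 <= M by apply: le_trans (qM 0 _); rewrite ?normr_ge0 // normr0 ler01.
set d := - 'Re p.[0]; have d0 : 0 < d by rewrite oppr_gt0.
have Md0 : 0 < M + d by rewrite ltr_wpDl.
(* With this e, the error e M stays below d = - Re p(0). *)
pose e := d / (M + d).
have e0 : 0 < e by rewrite divr_gt0.
have e1 : e <= 1 by rewrite ler_pdivrMr // mul1r lerDr.
have := pos _ e0; apply/negP; rewrite -real_ltNge ?Creal_Re ?rpred0 //.
have -> : p.[e] = p.[0] + e * q.[e].
  have := congr1 (fun r => r.[e]) pE; rewrite !hornerE subr0 mulrC => <-.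
  by rewrite addrC subrK.
rewrite raddfD /= -[X in X + _]opprK -/d addrC subr_lt0.
rewrite ReMl ?gtr0_real //; apply: (@le_lt_trans _ _ (e * M)).
  rewrite ler_pM2l //; apply: le_trans (qM e _); last by rewrite gtr0_norm.
  by rewrite leif_Re_Creal.
by rewrite /e mulrAC ltr_pdivrMr // ltr_pM2l // ltrDl.
Qed.

(** Conjugating the coefficients of q gives a polynomial whose values at real e are
    conj q(e), so the product is a polynomial in e. *)
Lemma Re_limit_ge0 p q :
    (forall e, 0 < e -> 0 <= 'Re (p.[e] * (q.[e])^*)) ->
  0 <= 'Re (p.[0] * (q.[0])^*).
Proof.
have E e : 0 <= e -> p.[e] * (q.[e])^* = (p * map_poly Num.conj q).[e].
  move=> e0; rewrite hornerM; congr (_ * _).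
  by rewrite -[in RHS](CrealP (ger0_real e0)) horner_map.
move=> pos; rewrite E //; apply: Re_horner0_ge0 => e e0.
by rewrite -E ?pos // ltW.
Qed.

(** The n-th roots of v sum to 0 when n > 1, so one of them has positive real part
    unless all are purely imaginary; in that case v = w^n with conj w = - w would be
    real or purely imaginary. *)
Lemma root_in_half_plane n v : (1 < n)%N -> 'Re v != 0 -> 'Im v != 0 ->
  exists2 w, 0 < 'Re w & w ^+ n = v.
Proof.
move=> n1 Rv Iv; have n0 : (0 < n)%N by apply: ltnW.
have [r rE] := closed_field_poly_normal ('X^n - v%:P).
rewrite lead_coefXnsubC // scale1r in rE.
have rn : size r = n.
  by have := congr1 (fun p : {poly C} => size p) rE;
    rewrite size_XnsubC // size_prod_XsubC => -[].
have rootr w : w \in r -> w ^+ n = v.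
  rewrite -root_prod_XsubC -rE rootE !hornerE subr_eq0.
  by move/eqP.
have sumr0 : \sum_(w <- r) w = 0.
  (* Minus the sum of the roots is the coefficient of degree n - 1. *)
  apply: oppr_inj; rewrite oppr0 -coefPn_prod_XsubC ?rn -?lt0n // -rE.
  rewrite coefB coefXn coefC (ltn_eqF (n := n)) ?prednK //.
  by rewrite gtn_eqF ?subr0 // -subn1 subn_gt0.
have [/hasP[w wr Rw]|/hasPn noR] := boolP (has (fun w => 0 < 'Re w) r).
  by exists w => //; exact: rootr.
have Rle w : w \in r -> 'Re w <= 0.
  by move=> /noR; rewrite -real_leNgt ?Creal_Re ?rpred0.
have R0 w : w \in r -> 'Re w = 0.
  move=> wr; apply/eqP; rewrite -oppr_eq0; move: wr.
  have : \sum_(w <- r) - 'Re w == 0 by rewrite sumrN -raddf_sum sumr0 raddf0 oppr0.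
  rewrite big_seq psumr_eq0 => [/allP all0 wr|w0 /Rle]; last by rewrite oppr_ge0.
  by have := all0 w wr; rewrite wr.
pose w := r`_0; have wr : w \in r by rewrite mem_nth ?rn.
have wJ : w^* = - w.
  by rewrite [w in RHS]Crect [w in LHS]Crect (R0 _ wr) !add0r rmorphM /= conjCi
     (CrealP (Creal_Im w)) mulNr.
have vJ : v^* = (-1) ^+ n * v by rewrite -(rootr w wr) rmorphXn /= wJ (exprNn w).
move: Rv Iv vJ; rewrite -signr_odd; case: (odd n) => /=.
  rewrite expr1 mulN1r => Rv _ vJ; move: Rv; rewrite ReE vJ subrr.
  by rewrite mul0r eqxx.
by rewrite expr0 mul1r => _ + vJ; rewrite ImE vJ subrr mulr0 mul0r eqxx.
Qed.

(** This excludes poles of order n > 1.  If c were nonzero, some v off both axes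
    would satisfy Re (c v) < 0, namely v = - conj c (1 + i t) with t = 0 or 1, and
    [root_in_half_plane] makes v an n-th power from the half-plane. *)
Lemma power_half_plane_eq0 n c : (1 < n)%N ->
  (forall w, 0 < 'Re w -> 0 <= 'Re (c * w ^+ n)) -> c = 0.
Proof.
move=> n1 pos; apply/eqP/negPn/negP => c0.
have absurd t : t \is Num.real -> 'Re c + t * 'Im c != 0 ->
    t * 'Re c - 'Im c != 0 -> False.
  move=> tr Rv Iv; pose v := - (c^* * (1 + 'i * t)).
  have vE : v = - ('Re c + t * 'Im c) + 'i * - (t * 'Re c - 'Im c).
    rewrite /v [c in LHS]Crect conjC_rect ?Creal_Re ?Creal_Im //.
    have i2 := @sqrCi C; move: ('Re c) ('Im c) => x y.
    by ring: i2.
  have [||w Rw wn] := @root_in_half_plane n v n1.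
  - by rewrite vE Re_rect ?oppr_eq0 ?rpredN ?rpredD ?rpredB ?rpredM ?rpredN ?Creal_Re ?Creal_Im.
  - by rewrite vE Im_rect ?oppr_eq0 ?rpredN ?rpredD ?rpredB ?rpredM ?rpredN ?Creal_Re ?Creal_Im.
  have := pos w Rw; rewrite wn /v mulrN mulrA -normCK raddfN /=.
  rewrite ReMl ?rpredX ?normr_real // Re_rect ?rpred1 // mulr1.
  by rewrite oppr_ge0 -normrX normr_le0 expf_eq0 (negPf c0) andbF.
(* Take t = 0 when both parts of c are nonzero, and t = 1 when exactly one is. *)
have [Rc|Rc] := eqVneq ('Re c) 0; have [Ic|Ic] := eqVneq ('Im c) 0.
- by rewrite [c]Crect Rc Ic mulr0 addr0 eqxx in c0.
- by apply: (absurd 1); rewrite ?rpred1 // Rc mul1r ?mul1r ?add0r ?sub0r ?oppr_eq0.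
- by apply: (absurd 1); rewrite ?rpred1 // Ic ?mulr0 ?mul1r ?addr0 ?subr0.
- by apply: (absurd 0); rewrite ?rpred0 // !mul0r ?addr0 // sub0r oppr_eq0.
Qed.

(** The vertical line w = 1 + i t gives Re c >= t Im c for all real t. *)
Lemma linear_half_plane_ge0 c :
  (forall w, 0 < 'Re w -> 0 <= 'Re (c * w)) -> 0 <= c.
Proof.
move=> pos.
have pos_line t : t \is Num.real -> 0 <= 'Re c - t * 'Im c.
  move=> tr; have := pos (1 + 'i * t); rewrite Re_rect ?rpred1 // ltr01 => /(_ isT).
  rewrite [c in 'Re (c * _)]Crect.
  have -> : ('Re c + 'i * 'Im c) * (1 + 'i * t) =
     ('Re c - t * 'Im c) + 'i * ('Im c + t * 'Re c).
    by have i2 := @sqrCi C; move: ('Re c) ('Im c) => x y; ring: i2.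
  by rewrite Re_rect ?rpredB ?rpredD ?rpredM ?Creal_Re ?Creal_Im.
have Rc : 0 <= 'Re c by have := pos_line 0 (rpred0 _); rewrite mul0r subr0.
have [Ic|Ic] := eqVneq ('Im c) 0.
  by rewrite [c]Crect Ic mulr0 addr0.
(* This t would make the bound equal to -1. *)
have := pos_line (('Re c + 1) / 'Im c).
rewrite rpred_div ?rpredD ?rpred1 ?Creal_Re ?Creal_Im // => /(_ isT).
by rewrite divfK // opprD addrA subrr add0r oppr_ge0 ler10.
Qed.

Definition positive_fun f :=
  forall z, 0 < 'Re z -> exists2 v, has_value f z v & 0 <= 'Re v.

(** Re (p / q) and Re (p conj q) have the same sign; the second is suited to limits at
    zeros of q. *)
Lemma positive_fun_ratio f z : positive_fun f -> 0 < 'Re z ->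
  (ratden f).[z] != 0 /\ 0 <= 'Re ((ratnum f).[z] * ((ratden f).[z])^*).
Proof.
move=> pos Rz; have [v [fz <-] Rv] := pos z Rz; split=> //.
have -> : (ratnum f).[z] * ((ratden f).[z])^* =
    rateval f z * `|(ratden f).[z]| ^+ 2.
  by rewrite normCK mulrA divfK.
by rewrite ReMr ?rpredX ?normr_real // mulr_ge0 ?exprn_ge0.
Qed.

(** Let n be the order of the pole at a.  Along z = a + e w with e > 0 tending to 0,
    positivity becomes Re (c w^n) >= 0 after w is conjugated; c = p(a) conj q(a) is
    nonzero for n > 0 since the fraction is reduced. *)
Lemma positive_fun_residue f a : positive_fun f -> 'Re a = 0 ->
  exists2 v, residue f a v & 0 <= v.
Proof.
move=> pos Ra.
have [n [q q_a qE]] := multiplicity_XsubC (ratden f) a.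
rewrite ratden_neq0 /= rootE in q_a.
pose c := (ratnum f).[a] * (q.[a])^*.
have X0 : ('X - a%:P)%:F != 0 by rewrite tofrac_eq0 polyXsubC_eq0.
have fE : f = (ratnum f)%:F / (q%:F * ('X - a%:P)%:F ^+ n).
  by rewrite -tofracXn -tofracM -qE -rat_numden.
have cpos w : 0 < 'Re w -> 0 <= 'Re (c * w ^+ n).
  move=> Rw; pose L := a%:P + w^* *: 'X.
  have LE e : L.[e] = a + w^* * e by rewrite !hornerE.
  have := @Re_limit_ge0 (ratnum f \Po L) ((w^* ^+ n) *: (q \Po L)).
  rewrite hornerZ !horner_comp LE mulr0 addr0 rmorphM rmorphXn /= conjCK.
  rewrite mulrCA [w ^+ n * _]mulrC; apply => e e0.
  rewrite hornerZ !horner_comp LE; set z := a + _.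
  have er : e \is Num.real by rewrite gtr0_real.
  have Rz : 0 < 'Re z.
    by rewrite raddfD /= Ra add0r ReMr // Re_conj mulr_gt0.
  have [_] := positive_fun_ratio pos Rz.
  have -> : (ratden f).[z] = e ^+ n * (w^* ^+ n * q.[z]).
    by rewrite qE hornerM horner_exp hornerXsubC addrC addKr exprMn; ring.
  rewrite [(e ^+ n * _)^*]rmorphM /= (CrealP (rpredX n er)) mulrCA.
  by rewrite ReMl ?rpredX // pmulr_rge0 ?exprn_gt0.
case: n {X0} qE fE cpos => [|[|n]] qE fE cpos.
- exists 0 => //; rewrite /residue.
  have -> : 0 = (a - a) * ((ratnum f).[a] / (ratden f).[a]) by rewrite subrr mul0r.
  apply: valueM; first by have := value_poly ('X - a%:P) a; rewrite hornerXsubC.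
  have da : (ratden f).[a] != 0 by rewrite qE !hornerE.
  by have := ratio_value (ratnum f) da; rewrite -rat_numden.
- exists ((ratnum f).[a] / q.[a]); last first.
    have -> : (ratnum f).[a] / q.[a] = c / `|q.[a]| ^+ 2.
      rewrite /c normCK; have : (q.[a])^* != 0 by rewrite conjC_eq0.
      by move: ((q.[a])^*) => d d0; field; rewrite d0.
    rewrite divr_ge0 ?exprn_ge0 //; exact: linear_half_plane_ge0.
  rewrite /residue [X in _ * X]fE expr1.
  suff -> : ('X - a%:P)%:F * ((ratnum f)%:F / (q%:F * ('X - a%:P)%:F)) =
      (ratnum f)%:F / q%:F by apply: ratio_value.
  by rewrite mulrCA invfM [_ / _]mulrC mulVKf // tofrac_eq0 polyXsubC_eq0.
- have := power_half_plane_eq0 (isT : (1 < n.+2)%N) cpos.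
  move/eqP; rewrite mulf_eq0 conjC_eq0 (negPf q_a) orbF.
  have rd : root (ratden f) a by rewrite qE exprS !rootM root_XsubC eqxx orbT.
  have /coprimep_root : coprimep (ratden f) (ratnum f).
    by rewrite coprimep_sym coprimep_ratnum_ratden.
  by move=> /(_ _ rd) /negPf ->.
Qed.

Definition bounded_at_infinity f :=
  exists p q, [/\ f = p%:F / q%:F, q != 0 & (size p <= size q)%N].

(** The relation f(z) = v z + O(1) at infinity, the counterpart there of [residue]. *)
Definition growth f v := bounded_at_infinity (f - constf v * ('X)%:F).

(** As a polynomial in e, this is e^(deg p) p(w / e): it serves to let z = w / e
    tend to infinity along the ray through w. *)
Definition revpoly (p : {poly C}) w :=
  \poly_(i < size p) (p`_((size p).-1 - i) * w ^+ ((size p).-1 - i)).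

Lemma horner_revpoly p w e : e != 0 ->
  (revpoly p w).[e] = e ^+ (size p).-1 * p.[w / e].
Proof.
move=> e0; rewrite horner_poly horner_coef mulr_sumr.
rewrite (reindex_inj rev_ord_inj) /=; apply: eq_bigr => i _.
have i_le : (i <= (size p).-1)%N by rewrite -ltnS (ltn_predK (ltn_ord i)).
have -> : (size p - i.+1 = (size p).-1 - i)%N by rewrite -subn1 -subnDA add1n.
rewrite subKn // -mulrA [RHS]mulrCA; congr (_ * _).
by rewrite expr_div_n mulrCA; congr (_ * _); rewrite expfB_cond ?(negPf e0).
Qed.

Lemma horner_revpoly0 p w : (revpoly p w).[0] = lead_coef p * w ^+ (size p).-1.
Proof.
rewrite horner_coef0 coef_poly subn0 size_poly_gt0.
by have [->|//] := eqVneq p 0; rewrite lead_coef0 mul0r.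
Qed.

(** The argument of [positive_fun_residue] at infinity, with e tending to 0 in
    z = w / e and n the difference of the degrees of numerator and denominator. *)
Lemma positive_fun_growth f : positive_fun f -> exists2 v, growth f v & 0 <= v.
Proof.
move=> pos; pose p := ratnum f; pose q := ratden f.
have q0 : q != 0 by exact: ratden_neq0.
have lq0 : lead_coef q != 0 by rewrite lead_coef_eq0.
have lq : (lead_coef q)^* != 0 by rewrite conjC_eq0.
have small : (size p <= size q)%N -> exists2 v, growth f v & 0 <= v.
  move=> le_pq; exists 0 => //; exists p, q; split=> //.
  by rewrite rmorph0 mul0r subr0; exact: rat_numden.
have [/small //|lt_qp] := leqP (size p) (size q).
have p0 : p != 0 by rewrite -size_poly_gt0 (leq_ltn_trans _ lt_qp).
pose c := lead_coef p * (lead_coef q)^*; pose n := (size p - size q)%N.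
have sizeE : (size p).-1 = ((size q).-1 + n)%N.
  rewrite -[in LHS](subnKC (ltnW lt_qp)) -/n.
  by move: (size q) (size_poly_gt0 q) => [|k] //; rewrite q0.
have cpos w : 0 < 'Re w -> 0 <= 'Re (c * w ^+ n).
  move=> Rw.
  have w0 : w != 0 by apply: contraTneq Rw => ->; rewrite raddf0 ltxx.
  have := @Re_limit_ge0 (revpoly p w) (revpoly q w).
  rewrite !horner_revpoly0 sizeE.
  have -> : lead_coef p * w ^+ ((size q).-1 + n) *
      (lead_coef q * w ^+ (size q).-1)^* =
      `|w ^+ (size q).-1| ^+ 2 * (c * w ^+ n).
    have E (x y z t s : C) : x * (y * z) * (t * s) = y * s * (x * t * z) by ring.
    by rewrite normCK rmorphM /= exprD /c E.
  rewrite ReMl ?rpredX ?normr_real // pmulr_rge0 ?exprn_gt0 ?normr_gt0 ?expf_neq0 //.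
  apply => e e0; rewrite !horner_revpoly ?gt_eqF //.
  have er : e \is Num.real by rewrite gtr0_real.
  have Rz : 0 < 'Re (w / e) by rewrite ReMr ?rpredV // divr_gt0.
  rewrite rmorphM /= (CrealP (rpredX _ er)) mulrACA.
  rewrite ReMl ?rpredM ?rpredX // pmulr_rge0 ?mulr_gt0 ?exprn_gt0 //.
  exact: (positive_fun_ratio pos Rz).2.
have c0 : c != 0 by rewrite mulf_neq0 ?lead_coef_eq0.
have [n1|/power_half_plane_eq0/(_ cpos)/eqP] := leqP n 1; last by rewrite (negPf c0).
have nE : n = 1%N by apply/eqP; rewrite eqn_leq n1 subn_gt0.
have spE : size p = (size q).+1.
  by rewrite -(subnK (ltnW lt_qp)) -/n nE.
have vE : c / `|lead_coef q| ^+ 2 = lead_coef p / lead_coef q.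
  by rewrite normCK /c -mulf_div divff // mulr1.
exists (lead_coef p / lead_coef q); last first.
  rewrite -vE divr_ge0 ?exprn_ge0 //; apply: linear_half_plane_ge0 => w.
  by have := cpos w; rewrite nE.
move: (lead_coef p / lead_coef q) (divfK lq0 (lead_coef p)) => v vE'.
exists (p - v *: (q * 'X)), q; split=> //.
  rewrite [f in LHS]rat_numden -/p -/q tofracB -mul_polyC !tofracM mulrBl.
  by congr (_ - _); rewrite [q%:F * _]mulrC mulrA mulfK // tofrac_eq0.
apply/leq_sizeP => j; rewrite leq_eqVlt => /orP[/eqP<-|lt_j].
  rewrite coefB coefZ coefMX -[X in _ - X]/(v * _).
  have -> : p`_(size q) = lead_coef p by rewrite lead_coefE spE.
  by rewrite size_poly_eq0 (negPf q0) -lead_coefE vE' subrr.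
case: j lt_j => // j lt_j; rewrite coefB coefZ coefMX /=.
by rewrite (nth_default _ (s := p)) ?spE // nth_default // mulr0 subr0.
Qed.

End HalfPlane.

(** * Growth at infinity, quadratic forms and polarization *)

Section Growth.
Variable C : numClosedFieldType.
Implicit Types (a c r v w : C) (p q : {poly C}) (f g : {fraction {poly C}}).

Lemma boundedD f g : bounded_at_infinity f -> bounded_at_infinity g ->
  bounded_at_infinity (f + g).
Proof.
move=> [p [q [-> q0 pq]]] [p' [q' [-> q0' pq']]].
rewrite ratioD //; exists (p * q' + p' * q), (q * q'); split=> //.
  by rewrite mulf_neq0.
have size_le (p1 p2 q1 q2 : {poly C}) : (size p1 <= size q1)%N ->
    (size p2 <= size q2)%N -> q1 != 0 -> q2 != 0 ->
    (size (p1 * p2)%R <= size (q1 * q2)%R)%N.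
  move=> le1 le2 q10 q20; rewrite (size_mul q10 q20).
  by rewrite (leq_trans (size_polyMleq _ _)) // -!subn1 leq_sub2r // leq_add.
rewrite (leq_trans (size_polyD _ _)) // geq_max size_le //=.
by rewrite [q * q']mulrC size_le.
Qed.

Lemma bounded_scale c f : bounded_at_infinity f ->
  bounded_at_infinity (constf c * f).
Proof.
move=> [p [q [-> q0 pq]]]; exists (c *: p), q; split=> //.
  by rewrite -mul_polyC tofracM mulrA.
exact: leq_trans (size_scale_leq _ _) pq.
Qed.

Lemma bounded0 : bounded_at_infinity (0 : {fraction {poly C}}).
Proof. by exists 0, 1; rewrite tofrac0 mul0r oner_neq0 size_poly0. Qed.

Lemma bounded_polar r a : bounded_at_infinity (polar r a).
Proof.
exists r%:P, ('X - a%:P); split=> //; first by rewrite polyXsubC_eq0.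
by rewrite size_XsubC (leq_trans (size_polyC_leq1 _)).
Qed.

Lemma bounded_poly p : bounded_at_infinity p%:F -> (size p <= 1)%N.
Proof.
move=> [p1 [q [E q0 le]]]; have [->|p0] := eqVneq p 0; first by rewrite size_poly0.
have pE : p * q = p1.
  by apply/eqP; rewrite -tofrac_eq tofracM E divfK // tofrac_eq0.
by move: le; rewrite -pE (size_mul p0 q0) -subn1 leq_subLR leq_add2r.
Qed.

Lemma growthD f g v w : growth f v -> growth g w -> growth (f + g) (v + w).
Proof. by move=> /boundedD fv /fv; rewrite /growth rmorphD mulrDl opprD addrACA. Qed.

Lemma growth_scale c f v : growth f v -> growth (constf c * f) (c * v).
Proof. by move/(bounded_scale c); rewrite /growth rmorphM mulrBr mulrA. Qed.

Lemma growth0_eq0 v : growth 0 v -> v = 0.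
Proof.
rewrite /growth sub0r -mulNr -rmorphN -tofracM mul_polyC => /bounded_poly.
apply: contraTeq => v0; rewrite size_scale ?oppr_eq0 //.
by rewrite size_polyX.
Qed.

End Growth.

Section QuadraticForms.
Variables (C : numClosedFieldType) (A : comNzRingType) (iota : {rmorphism C -> A}).
Variable m : nat.
Implicit Types (F : 'M[A]_m) (u w : 'cV[C]_m).

(** The sesquilinear form is parametrized by an embedding iota of the scalars, so
    that the same computations serve for matrices of numbers and of fractions. *)
Definition sesq F u w := \sum_i \sum_j iota ((u i 0)^* * w j 0) * F i j.

Lemma sesqDl F u u' w : sesq F (u + u') w = sesq F u w + sesq F u' w.
Proof.
rewrite /sesq -big_split; apply: eq_bigr => i _; rewrite -big_split.
by apply: eq_bigr => j _; rewrite !mxE rmorphD /= mulrDl rmorphD mulrDl.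
Qed.

Lemma sesqDr F u w w' : sesq F u (w + w') = sesq F u w + sesq F u w'.
Proof.
rewrite /sesq -big_split; apply: eq_bigr => i _; rewrite -big_split.
by apply: eq_bigr => j _; rewrite !mxE mulrDr rmorphD mulrDl.
Qed.

Lemma sesq_delta F a b i j :
  sesq F (a *: delta_mx i 0) (b *: delta_mx j 0) = iota (a^* * b) * F i j.
Proof.
rewrite /sesq (bigD1 i) //= (bigD1 j) //= !mxE !eqxx !mulr1 !big1 ?addr0 //.
  move=> k ki; rewrite big1 // => l _.
  by rewrite !mxE (negPf ki) mulr0 conjC0 mul0r rmorph0 mul0r.
by move=> k kj; rewrite !mxE (negPf kj) !mulr0 rmorph0 mul0r.
Qed.

(** Entries are fixed linear combinations of values of the quadratic form, so linear
    information on all the scalar functions given by F passes to its entries. *)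
Lemma polarization F i j :
  let e k := delta_mx k 0 : 'cV[C]_m in
  let q u := sesq F u u in
  F i j = iota 2^-1 * (q (e i + e j) + iota (- 'i) * q (e i + 'i *: e j)
           + iota ('i - 1) * (q (e i) + q (e j))).
Proof.
move=> e q.
have qE a b : q (a *: e i + b *: e j) = iota (a^* * a) * F i i
    + iota (a^* * b) * F i j + (iota (b^* * a) * F j i + iota (b^* * b) * F j j).
  by rewrite /q sesqDl !sesqDr !sesq_delta.
have := qE 1 1; rewrite !scale1r => ->.
have := qE 1 'i; rewrite !scale1r => ->.
have := qE 1 0; rewrite !scale1r scale0r addr0 => ->.
have := qE 0 1; rewrite !scale1r scale0r add0r => ->.
rewrite conjC0 conjC1 conjCi !(mulr0, mul0r, mulr1, mul1r).
rewrite mulNr -expr2 sqrCi opprK !(rmorph0, rmorph1) rmorphB !rmorphN.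
have i2 : iota 'i * iota 'i = -1 by rewrite -rmorphM -expr2 sqrCi rmorphN1.
have h2 : iota 2^-1 * iota 2 = 1 by rewrite -rmorphM mulVf ?rmorph1 // pnatr_eq0.
rewrite rmorph_nat in h2.
rewrite rmorph1; move: (iota 'i) (iota 2^-1) i2 h2 => x h x2 h2.
transitivity (h * 2 * F i j); first by rewrite h2 mul1r.
by ring: x2.
Qed.

End QuadraticForms.

Notation qform A u := (sesq idfun A u u).

Section PositiveForms.
Variables (C : numClosedFieldType) (m : nat).
Implicit Types (A B : 'M[C]_m) (u : 'cV[C]_m).

Lemma mxquadE A u : ((u ^t*) *m A *m u)%sesqui 0 0 = qform A u.
Proof.
rewrite /sesq exchange_big /= mxE; apply: eq_bigr => j _.
rewrite mxE mulr_suml; apply: eq_bigr => i _.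
by rewrite !mxE mulrAC.
Qed.

Lemma qform_conj_trmx A u : qform (A ^t*)%sesqui u = (qform A u)^*.
Proof.
rewrite /sesq exchange_big rmorph_sum /=; apply: eq_bigr => i _.
rewrite rmorph_sum /=; apply: eq_bigr => j _.
by rewrite !mxE !rmorphM /= conjCK [u i 0 * _]mulrC.
Qed.

Lemma qformD A B u : qform (A + B) u = qform A u + qform B u.
Proof.
rewrite /sesq -big_split; apply: eq_bigr => i _; rewrite -big_split.
by apply: eq_bigr => j _; rewrite !mxE mulrDr.
Qed.

Lemma qformZ c A u : qform (c *: A) u = c * qform A u.
Proof.
rewrite /sesq mulr_sumr; apply: eq_bigr => i _; rewrite mulr_sumr.
by apply: eq_bigr => j _; rewrite !mxE mulrCA.
Qed.

Lemma qformN A u : qform (- A) u = - qform A u.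
Proof. by rewrite -scaleN1r qformZ mulN1r. Qed.

Lemma hermsymP A : reflect (A = (A ^t*)%sesqui) (A \is hermsymmx).
Proof.
apply: (iffP (is_hermitianmxP _ _ _)); by rewrite expr0 scale1r.
Qed.

(** Hermitian symmetry comes for free: a form that is real at all u has a vanishing
    anti-Hermitian part by polarization. *)
Lemma mxpsdP A : mxpsd A <-> forall u, 0 <= qform A u.
Proof.
split=> [[_ psdA] u|psdA]; first by rewrite -mxquadE.
split=> [|u]; last by rewrite mxquadE.
apply/hermsymP/eqP; rewrite -subr_eq0; apply/eqP/matrixP => i j.
have D0 u : qform (A - (A ^t*)%sesqui) u = 0.
  rewrite qformD qformN qform_conj_trmx.
  by rewrite (CrealP (ger0_real (psdA u))) subrr.
by rewrite (polarization idfun) !D0 /= !(mulr0, addr0) mxE.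
Qed.

End PositiveForms.

Section Coefficients.
Variables (C : numClosedFieldType) (m : nat) (F : 'M[{fraction {poly C}}]_m).
Variable rel : {fraction {poly C}} -> C -> Prop.
Hypothesis rel0_eq0 : forall v, rel 0 v -> v = 0.
Hypothesis relD : forall f g v w, rel f v -> rel g w -> rel (f + g) (v + w).
Hypothesis rel_scale : forall c f v, rel f v -> rel (constf c * f) (c * v).
Hypothesis rel_form : forall u, exists2 v, rel (sesq (@constf C) F u u) v & 0 <= v.

(** Residues at a point and growth coefficients at infinity are both linear partial
    functionals rel on rational functions.  If such a functional is defined and
    nonnegative on all scalar functions conj u^T F u, it is defined on the entries of F by
    polarization, and its values form a positive semidefinite matrix. *)
Lemma psd_coefficient :
  exists2 A : 'M[C]_m, mxpsd A & forall i j, rel (F i j) (A i j).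
Proof.
have rel_ex i j : exists v, rel (F i j) v.
  have q u : exists v, rel (sesq (@constf C) F u u) v.
    by have [v ? _] := rel_form u; exists v.
  rewrite (polarization (@constf C) F i j).
  have [v1 ?] := q (delta_mx i 0 + delta_mx j 0).
  have [v2 ?] := q (delta_mx i 0 + 'i *: delta_mx j 0).
  have [v3 ?] := q (delta_mx i 0).
  have [v4 ?] := q (delta_mx j 0).
  eexists; apply: rel_scale; apply: relD; last first.
    by apply: rel_scale; apply: relD; eassumption.
  by apply: relD; last apply: rel_scale; eassumption.
have [A0 A0P] := fin_all_exists (fun i => fin_all_exists (rel_ex i)).
pose A := \matrix_(i, j) A0 i j.
have AP i j : rel (F i j) (A i j) by rewrite mxE.
exists A => //; apply/mxpsdP => u; have [v vP v0] := rel_form u.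
have rel00 f w : rel f w -> rel 0 0.
  by move=> /(rel_scale 0); rewrite rmorph0 !mul0r.
have relS (I : Type) (r : seq I) (f : I -> {fraction {poly C}}) (w : I -> C) :
    rel 0 0 -> (forall i, rel (f i) (w i)) ->
    rel (\sum_(i <- r) f i) (\sum_(i <- r) w i).
  by move=> r0 fw; apply: (big_rec2 rel) => // i g x _; exact: relD.
suff -> : qform A u = v by [].
apply/eqP; rewrite -subr_eq0; apply/eqP/rel0_eq0.
have -> : 0 = sesq (@constf C) F u u + constf (-1) * sesq (@constf C) F u u.
  by rewrite rmorphN1 mulN1r subrr.
rewrite -[X in _ - X]mul1r -mulNr; apply: relD; last exact: rel_scale.
have r0 := rel00 _ _ vP.
by apply: (relS) => // i; apply: (relS) => // j; exact: (rel_scale _ (AP i j)).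
Qed.

End Coefficients.

(** * Expansion of positive matrix functions *)

Section MatrixValues.
Variables (K : fieldType) (m : nat).
Implicit Types (F : 'M[{fraction {poly K}}]_m) (z : K).

Lemma mxvalue F z i j : ~~ is_mxpole F z -> has_value (F i j) z (mxeval F z i j).
Proof.
rewrite negb_exists => /forallP/(_ i); rewrite negb_exists => /forallP/(_ j).
by move=> Fij; rewrite mxE.
Qed.

Lemma mxvalueI F z (V : 'M[K]_m) : (forall i j, has_value (F i j) z (V i j)) ->
  ~~ is_mxpole F z /\ mxeval F z = V.
Proof.
move=> FV; split; last by apply/matrixP => i j; rewrite mxE (FV i j).2.
rewrite negb_exists; apply/forallP => i; rewrite negb_exists; apply/forallP => j.
exact: (FV i j).1.
Qed.

End MatrixValues.

Section PositiveMatrixFunctions.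
Variables (C : numClosedFieldType) (m : nat).
Implicit Types (F : 'M[{fraction {poly C}}]_m) (z : C).

Definition positive_mxfun F := forall z, 0 < 'Re z ->
  ~~ is_mxpole F z /\ mxpsd (mxRe (mxeval F z)).

Lemma qform_mxRe (E : 'M[C]_m) u : qform (mxRe E) u = 'Re (qform E u).
Proof. by rewrite ReE qformZ qformD qform_conj_trmx mulrC. Qed.

Lemma positive_mxfun_form F u : positive_mxfun F ->
  positive_fun (sesq (@constf C) F u u).
Proof.
move=> pos z /pos[Fz /mxpsdP psd]; exists (qform (mxeval F z) u).
  apply: value_sum => i _; apply: value_sum => j _.
  by apply: valueM; [exact: value_const | exact: mxvalue].
by rewrite -qform_mxRe.
Qed.

(** Meaningful when all entries have at most a simple pole at a. *)
Definition mxresidue F (a : C) : 'M[C]_m :=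
  \matrix_(i, j) rateval (('X - a%:P)%:F * F i j) a.

Lemma residueD (f g : {fraction {poly C}}) a v w :
  residue f a v -> residue g a w -> residue (f + g) a (v + w).
Proof. by move=> fv gw; rewrite /residue mulrDr; exact: valueD. Qed.

Lemma residue_scale c (f : {fraction {poly C}}) a v :
  residue f a v -> residue (constf c * f) a (c * v).
Proof.
by move=> fv; rewrite /residue mulrCA; apply: valueM => //; exact: value_const.
Qed.

Lemma residue0_eq0 (a v : C) : residue 0 a v -> v = 0.
Proof.
rewrite /residue mulr0 => /value_unique; apply.
by have := value_const 0 a; rewrite rmorph0.
Qed.

Lemma positive_mxfun_residue F a : positive_mxfun F -> 'Re a = 0 ->
  mxpsd (mxresidue F a) /\ forall i j, residue (F i j) a (mxresidue F a i j).
Proof.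
move=> pos Ra.
have [||||A psdA resA] := @psd_coefficient C m F (fun f v => residue f a v).
- exact: residue0_eq0.
- by move=> f g v w; exact: residueD.
- by move=> c f v; exact: residue_scale.
- by move=> u; apply: positive_fun_residue => //; exact: positive_mxfun_form.
suff -> : mxresidue F a = A by [].
by apply/matrixP => i j; rewrite mxE (resA i j).2.
Qed.

Lemma positive_mxfun_growth F : positive_mxfun F ->
  exists2 Q : 'M[C]_m, mxpsd Q & forall i j, growth (F i j) (Q i j).
Proof.
move=> pos; apply: psd_coefficient.
- exact: growth0_eq0.
- exact: growthD.
- exact: growth_scale.
by move=> u; apply: positive_fun_growth; exact: positive_mxfun_form.
Qed.

(** The poles are among the roots of the product of all denominators. *)
Lemma mxpole_seq F : exists2 s : seq C, uniq s & forall z, (z \in s) = is_mxpole F z.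
Proof.
pose D := \prod_i \prod_j ratden (F i j).
have [r rE] := closed_field_poly_normal D.
have D0 : D != 0.
  by rewrite /D prodf_seq_neq0; apply/allP => i _ /=;
     rewrite prodf_seq_neq0; apply/allP => j _ /=; rewrite ratden_neq0.
exists (undup [seq z <- r | is_mxpole F z]) => [|z]; first exact: undup_uniq.
rewrite mem_undup mem_filter andb_idr // => /existsP[i /existsP[j Fij]].
have : root D z.
  by rewrite /D (bigD1 i) //= (bigD1 j) //= !rootM [root _ z]Fij.
by rewrite rE rootZ ?lead_coef_eq0 // root_prod_XsubC.
Qed.

(** Comparing growth at infinity shows that the polynomial part minus X Q is
    bounded, hence constant. *)
Lemma positive_mxfun_expansion F : positive_mxfun F ->
    (forall z, is_mxpole F z -> 'Re z = 0) ->
  exists (s : seq C) (Q B : 'M[C]_m),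
  [/\ mxpsd Q,
      forall a, a \in s -> 'Re a = 0,
      forall a, a \in s -> mxpsd (mxresidue F a)
    & forall i j, F i j = constf (Q i j) * ('X)%:F + constf (B i j)
                          + \sum_(a <- s) polar (mxresidue F a i j) a].
Proof.
move=> pos imag; have [s us sE] := mxpole_seq F.
have [Q psdQ QE] := positive_mxfun_growth pos.
have Rs a : a \in s -> 'Re a = 0 by rewrite sE => /imag.
have res a : a \in s -> mxpsd (mxresidue F a) /\
    forall i j, residue (F i j) a (mxresidue F a i j).
  by move=> /Rs; exact: positive_mxfun_residue.
have exB i j : exists b, F i j = constf (Q i j) * ('X)%:F + constf b
                          + \sum_(a <- s) polar (mxresidue F a i j) a.
  have [|| p pE] := @partial_fractions C (F i j) s (fun a => mxresidue F a i j) us.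
  - by move=> a /res[_]; apply.
  - by move=> z; rewrite sE => /(mxvalue i j)[].
  have := QE i j; rewrite /growth pE addrAC => grow.
  have bnd : bounded_at_infinity (- \sum_(a <- s) polar (mxresidue F a i j) a).
    rewrite -mulN1r -(rmorphN1 (@constf C)); apply: bounded_scale.
    apply: (big_rec (@bounded_at_infinity C)) => [|a g _]; first exact: bounded0.
    by apply: boundedD; exact: bounded_polar.
  have := boundedD grow bnd; rewrite addrK -tofracM -tofracB.
  move=> /bounded_poly/size1_polyC pB; exists (p - (Q i j)%:P * 'X)`_0.
  congr (_ + _); rewrite -[X in _ + X]/(_ %:P)%:F -pB tofracB tofracM.
  by rewrite addrC subrK.
have [B0 B0P] := fin_all_exists (fun i => fin_all_exists (exB i)).
exists s, Q, (\matrix_(i, j) B0 i j); split=> //.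
  by move=> a /res[].
by move=> i j; rewrite mxE.
Qed.

End PositiveMatrixFunctions.

(** * Foster expansions are positive, real and odd *)

Section ConjugateFractions.
Variables (C : numClosedFieldType) (tau : {rmorphism {poly C} -> {poly C}}).
Variable phi : C -> C.
Hypothesis tau_eval : forall p z, (tau p).[phi z] = (p.[z])^*.
Hypothesis tau_inj : injective tau.
Implicit Types (f g : {fraction {poly C}}) (p q : {poly C}) (z : C).

(** g is obtained from f by applying tau to numerator and denominator.  Stating this
    as a relation avoids extending tau to the field of fractions; when tau p at phi z
    is the conjugate of p at z, values of g at phi z are conjugates of values of f at z. *)
Definition conj_frac f g :=
  exists p q, [/\ q != 0, f = p%:F / q%:F & g = (tau p)%:F / (tau q)%:F].

Let tau_eq0 p : (tau p == 0) = (p == 0).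
Proof. by rewrite -(inj_eq tau_inj p) rmorph0. Qed.

(** The reduced form of f also represents g after tau is applied, by cross
    multiplication, and the denominator of that form does not vanish at phi z. *)
Lemma conj_frac_value f g z : conj_frac f g -> ~~ is_pole f z ->
  has_value g (phi z) (rateval f z)^*.
Proof.
move=> [p [q [q0 fE ->]]] fz; rewrite /rateval fmorph_div /= -!tau_eval.
suff -> : (tau p)%:F / (tau q)%:F = (tau (ratnum f))%:F / (tau (ratden f))%:F.
  by apply: ratio_value; rewrite tau_eval conjC_eq0.
apply/eqP; rewrite eqr_div ?tofrac_eq0 ?tau_eq0 ?ratden_neq0 //.
rewrite -!tofracM -!rmorphM tofrac_eq; apply/eqP; congr (tau _); apply/eqP.
by rewrite -tofrac_eq !tofracM -eqr_div ?tofrac_eq0 ?ratden_neq0 // -fE -rat_numden.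
Qed.

Lemma conj_frac_poly p : conj_frac p%:F (tau p)%:F.
Proof. by exists p, 1; rewrite oner_neq0 (rmorph1 tau) tofrac1 !divr1. Qed.

Lemma conj_fracD f g f' g' : conj_frac f f' -> conj_frac g g' ->
  conj_frac (f + g) (f' + g').
Proof.
move=> [p [q [q0 -> ->]]] [p' [q' [q0' -> ->]]].
exists (p * q' + p' * q), (q * q'); rewrite mulf_neq0 // ratioD //; split=> //.
by rewrite ratioD ?tau_eq0 // (rmorphD tau) !(rmorphM tau).
Qed.

Lemma conj_fracM f g f' g' : conj_frac f f' -> conj_frac g g' ->
  conj_frac (f * g) (f' * g').
Proof.
move=> [p [q [q0 -> ->]]] [p' [q' [q0' -> ->]]].
exists (p * p'), (q * q'); rewrite mulf_neq0 // ratioM; split=> //.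
by rewrite ratioM !(rmorphM tau).
Qed.

Lemma conj_fracV f f' : f != 0 -> conj_frac f f' -> conj_frac f^-1 f'^-1.
Proof.
move=> f0 [p [q [q0 fE ->]]]; exists q, p; rewrite fE !invf_div; split=> //.
by apply: contraNneq f0 => p0; rewrite fE p0 tofrac0 mul0r.
Qed.

Lemma conj_frac_sum (I : Type) (r : seq I) (f f' : I -> {fraction {poly C}}) :
  (forall i, conj_frac (f i) (f' i)) ->
  conj_frac (\sum_(i <- r) f i) (\sum_(i <- r) f' i).
Proof.
move=> ff; apply: (big_rec2 conj_frac) => [|i g g' _]; last exact: conj_fracD.
by have := conj_frac_poly 0; rewrite (rmorph0 tau) tofrac0.
Qed.

End ConjugateFractions.

Section FosterForm.
Variables (C : numClosedFieldType) (m s : nat).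
Variables (omega : 'I_s -> C) (Q R0 : 'M[C]_m) (Qj Rj : 'I_s -> 'M[C]_m).
Implicit Types z : C.

(** In the scalar case this is the expansion of Foster's reactance theorem. *)
Definition foster : 'M[{fraction {poly C}}]_m := \matrix_(i, j)
  (('X)%:F * constf (Q i j) + constf (R0 i j) +
   \sum_(k < s) (('X)%:F ^+ 2 + constf (omega k ^+ 2))^-1 *
                (('X)%:F * constf (Qj k i j) + constf (Rj k i j))).

Definition foster_val z : 'M[C]_m := z *: Q + R0 +
  \sum_(k < s) (z ^+ 2 + omega k ^+ 2)^-1 *: (z *: Qj k + Rj k).

Hypothesis omega_ge0 : forall k, 0 <= omega k.

Lemma sqrD_sqr_neq0 z w : w \is Num.real -> 'Re z != 0 -> z ^+ 2 + w ^+ 2 != 0.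
Proof.
move=> wr; apply: contraNneq => zw.
have : (z - 'i * w) * (z + 'i * w) == 0.
  by have i2 := @sqrCi C; rewrite -zw; apply/eqP; ring: i2.
have Riw : 'Re ('i * w) = 0 by rewrite ReMil (Creal_ImP _ wr) oppr0.
rewrite mulf_eq0 subr_eq0 addr_eq0 => /orP[]/eqP->; first by rewrite Riw.
by rewrite raddfN /= Riw oppr0.
Qed.

Lemma foster_value z : 'Re z != 0 ->
  forall i j, has_value (foster i j) z (foster_val z i j).
Proof.
move=> Rz i j; rewrite !mxE.
have Xz : has_value ('X)%:F z z by have := value_poly 'X z; rewrite hornerX.
apply: valueD.
  by apply: valueD; [apply: valueM => // |]; exact: value_const.
rewrite summxE; apply: value_sum => k _; rewrite !mxE; apply: valueM.
  apply: valueV; last by rewrite sqrD_sqr_neq0 // ger0_real.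
  by apply: valueD; [rewrite !expr2; exact: valueM | exact: value_const].
by apply: valueD; [apply: valueM => // |]; exact: value_const.
Qed.

(** With z = x + i y, the numerator of the real part is
    x (q (x^2 + (|y| - w)^2) + 2 (w q |y| - rho y)), and |rho| <= w q. *)
Lemma Re_elementary_ge0 z w q rho : 0 < 'Re z -> 0 <= w -> 0 <= q ->
    - (w * q) <= rho -> rho <= w * q ->
  0 <= 'Re ((z ^+ 2 + w ^+ 2)^-1 * (z * q - 'i * rho)).
Proof.
move=> Rz w0 q0 rho_ge rho_le.
have wq_real : w * q \is Num.real by rewrite ger0_real ?mulr_ge0.
have rho_real : rho \is Num.real by rewrite (ler_real rho_le).
have rho_norm : `|rho| <= w * q by rewrite real_ler_norml // rho_ge.
rewrite mulrC Re_div mulr_ge0 ?invr_ge0 ?exprn_ge0 //.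
set x := 'Re z in Rz *; set y := 'Im z.
have [xr yr] : x \is Num.real /\ y \is Num.real by rewrite Creal_Re Creal_Im.
have [wr qr] : w \is Num.real /\ q \is Num.real by rewrite !ger0_real.
have -> : z ^+ 2 + w ^+ 2 = (x ^+ 2 - y ^+ 2 + w ^+ 2) + 'i * (2 * x * y).
  by rewrite [z]Crect -/x -/y; have i2 := @sqrCi C; ring: i2.
have -> : z * q - 'i * rho = x * q + 'i * (y * q - rho).
  by rewrite [z]Crect -/x -/y; ring.
have real2 : 2 \is @Num.real C by rewrite realn.
rewrite !Re_rect ?Im_rect ?rpredB ?rpredD ?rpredN ?rpredM ?rpredX //.
have -> : x * q * (x ^+ 2 - y ^+ 2 + w ^+ 2) + (y * q - rho) * (2 * x * y) =
   x * (q * (x ^+ 2 + (`|y| - w) ^+ 2) + 2 * (w * q * `|y| - rho * y)).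
  have y2 : `|y| ^+ 2 = y ^+ 2 by rewrite real_normK.
  by ring: y2.
rewrite mulr_ge0 ?(ltW Rz) // addr_ge0 ?mulr_ge0 //.
  by rewrite addr_ge0 // -realEsqr ?rpredB ?normr_real.
rewrite subr_ge0; apply: le_trans (_ : `|rho| * `|y| <= _); last exact: ler_wpM2r.
by rewrite -normrM real_ler_norm ?rpredM.
Qed.

Hypothesis Q_real : Q \is a realmx.
Hypothesis R0_real : R0 \is a realmx.
Hypothesis Qj_real : forall k, Qj k \is a realmx.
Hypothesis Rj_real : forall k, Rj k \is a realmx.
Hypothesis Q_psd : mxpsd Q.
Hypothesis R0_skew : R0^T = - R0.
Hypothesis Qj_psd : forall k, mxpsd (Qj k).
Hypothesis Rj_skew : forall k, (Rj k)^T = - Rj k.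
Hypothesis Rj_ge : forall k, mxle (- (omega k *: Qj k)) ('i *: Rj k).
Hypothesis Rj_le : forall k, mxle ('i *: Rj k) (omega k *: Qj k).

Lemma qform_foster_val z u : qform (foster_val z) u =
  z * qform Q u + qform R0 u +
  \sum_(k < s) (z ^+ 2 + omega k ^+ 2)^-1 * (z * qform (Qj k) u + qform (Rj k) u).
Proof.
rewrite /foster_val !qformD qformZ; congr (_ + _).
apply: (big_rec2 (fun A a => qform A u = a)) => [|k a A _ <-].
  by rewrite -[0](scale0r (0 : 'M[C]_m)) qformZ mul0r.
by rewrite qformD qformZ qformD qformZ.
Qed.

(** A real skew-symmetric matrix is anti-Hermitian. *)
Lemma Re_qform_skew (A : 'M[C]_m) u :
  A \is a realmx -> A^T = - A -> 'Re (qform A u) = 0.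
Proof.
move=> A_real A_skew; rewrite ReE -qform_conj_trmx.
have -> : (A ^t*)%sesqui = - A.
  by rewrite A_skew map_mxN realmxC.
by rewrite qformN subrr mul0r.
Qed.

Lemma foster_psd z : 0 < 'Re z -> mxpsd (mxRe (foster_val z)).
Proof.
move=> Rz; apply/mxpsdP => u; rewrite qform_mxRe qform_foster_val.
rewrite !raddfD /= (Re_qform_skew _ R0_real R0_skew) addr0 raddf_sum /=.
have Q0 : 0 <= qform Q u by move/mxpsdP: Q_psd.
apply: addr_ge0; first by rewrite ReMr ?ger0_real // mulr_ge0 ?(ltW Rz).
apply: sumr_ge0 => k _.
have -> : qform (Rj k) u = - ('i * qform ('i *: Rj k) u).
  by rewrite qformZ mulrA -expr2 sqrCi mulN1r opprK.
apply: Re_elementary_ge0 => //; first by move/mxpsdP: (Qj_psd k).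
  have /mxpsdP/(_ u) := Rj_ge k.
  by rewrite qformD !qformN (qformZ (omega k)) subr_ge0.
have /mxpsdP/(_ u) := Rj_le k.
by rewrite qformD qformN (qformZ (omega k)) subr_ge0.
Qed.

Definition conj_poly : {rmorphism {poly C} -> {poly C}} := map_poly Num.conj.

Definition reflect_poly : {rmorphism {poly C} -> {poly C}} :=
  comp_poly (- 'X) \o map_poly Num.conj.

Lemma conj_poly_eval p z : (conj_poly p).[z^*] = (p.[z])^*.
Proof. exact: horner_map. Qed.

Lemma conj_poly_inj : injective conj_poly.
Proof. exact: map_poly_inj. Qed.

Lemma reflect_poly_eval p z : (reflect_poly p).[- z^*] = (p.[z])^*.
Proof. by rewrite /= horner_comp hornerN hornerX opprK horner_map. Qed.

Lemma reflect_poly_inj : injective reflect_poly.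
Proof.
move=> p q /(congr1 (comp_poly (- 'X))); rewrite /= -!comp_polyA.
by rewrite raddfN /= comp_polyX opprK !comp_polyXr => /map_poly_inj.
Qed.

Lemma sqrX_addC_neq0 c : ('X)%:F ^+ 2 + constf c != 0 :> {fraction {poly C}}.
Proof.
by rewrite -tofracXn -tofracD tofrac_eq0 -size_poly_gt0 size_XnaddC.
Qed.

Lemma conj_foster i j : conj_frac conj_poly (foster i j) (foster i j).
Proof.
have cD := conj_fracD conj_poly_inj.
have cX : conj_frac conj_poly ('X)%:F ('X)%:F.
  by have := conj_frac_poly conj_poly 'X; rewrite /= map_polyX.
have cC c : c \is Num.real -> conj_frac conj_poly (constf c) (constf c).
  move=> cr; have := conj_frac_poly conj_poly c%:P.
  by rewrite /= map_polyC /= (CrealP cr).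
have cA (A : 'M[C]_m) : A \is a realmx ->
    conj_frac conj_poly (constf (A i j)) (constf (A i j)).
  by move=> /mxOverP A_real; exact: cC.
rewrite !mxE; apply: (cD); first by apply: cD; [apply: conj_fracM => // |]; exact: cA.
apply: (conj_frac_sum conj_poly_inj) => k; apply: conj_fracM.
  apply: conj_fracV; first exact: sqrX_addC_neq0.
  apply: cD; first by rewrite expr2; exact: conj_fracM.
  by apply: cC; rewrite rpredX ?ger0_real.
by apply: cD; [apply: conj_fracM => // |]; exact: cA.
Qed.

(** Replacing z by -z changes the sign of the terms in Q and Q_j, which are Hermitian,
    while transposition changes the sign of R_0 and R_j. *)
Lemma reflect_foster i j : conj_frac reflect_poly (foster i j) (- foster j i).
Proof.
have cD := conj_fracD reflect_poly_inj.
have cX : conj_frac reflect_poly ('X)%:F (- ('X)%:F).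
  have := conj_frac_poly reflect_poly 'X.
  by rewrite /= map_polyX comp_polyX tofracN.
have cC c : conj_frac reflect_poly (constf c) (constf c^*).
  have := conj_frac_poly reflect_poly c%:P.
  by rewrite /= map_polyC /= comp_polyC.
have cC_real c : c \is Num.real -> conj_frac reflect_poly (constf c) (constf c).
  by move=> /CrealP {2}<-; exact: cC.
have cQ (A : 'M[C]_m) : mxpsd A ->
    conj_frac reflect_poly (constf (A i j)) (constf (A j i)).
  move=> [/hermsymP AE _].
  have -> : A j i = (A i j)^* by rewrite {1}AE !mxE.
  exact: cC.
have cR (A : 'M[C]_m) : A \is a realmx -> A^T = - A ->
    conj_frac reflect_poly (constf (A i j)) (- constf (A j i)).
  move=> /mxOverP A_real /matrixP/(_ i j); rewrite !mxE => ->.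
  by rewrite rmorphN opprK; exact: cC_real.
have cX2 k : conj_frac reflect_poly (('X)%:F ^+ 2 + constf (omega k ^+ 2))
    (('X)%:F ^+ 2 + constf (omega k ^+ 2)).
  apply: cD; last by apply: cC_real; rewrite rpredX ?ger0_real.
  by rewrite -[X in conj_frac _ _ X]sqrrN !expr2; exact: conj_fracM.
rewrite !mxE !opprD -sumrN -mulNr.
apply: (cD); first by apply: cD; [apply: conj_fracM (cQ _ _) | exact: cR].
apply: (conj_frac_sum reflect_poly_inj) => k; rewrite -mulrN opprD -mulNr.
apply: conj_fracM; first by apply: conj_fracV; rewrite ?sqrX_addC_neq0.
by apply: cD; [apply: conj_fracM (cQ _ _) | exact: cR].
Qed.

(** Positivity is checked where all terms are regular; the other two axioms come from
    the identities of fractions, hence hold at all regular points of the sum. *)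
Lemma foster_PRO_axioms :
  [/\ forall z, 0 < 'Re z -> ~~ is_mxpole foster z /\ mxpsd (mxRe (mxeval foster z)),
      forall t, t \is Num.real -> ~~ is_mxpole foster t -> mxeval foster t \is a realmx
    & forall z, ~~ is_mxpole foster z -> ~~ is_mxpole foster (- z^*) /\
        - mxeval foster z = ((mxeval foster (- z^*)) ^t*)%sesqui].
Proof.
split=> [z Rz|t tr Ft|z Fz].
- have [|Fz ->] := @mxvalueI _ _ foster z (foster_val z).
    by apply: foster_value; rewrite gt_eqF.
  by split=> //; exact: foster_psd.
- apply/mxOverP => i j; have Fij := mxvalue i j Ft.
  have := conj_frac_value conj_poly_eval conj_poly_inj (conj_foster i j) Fij.1.
  by rewrite (CrealP tr) Fij.2 => /(value_unique Fij)/esym/CrealP.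
pose V : 'M[C]_m := \matrix_(i, j) - (mxeval foster z j i)^*.
have [|Fz' ->] := @mxvalueI _ _ foster (- z^*) V.
  move=> i j; have Fji := mxvalue j i Fz.
  have := conj_frac_value reflect_poly_eval reflect_poly_inj (reflect_foster j i) Fji.1.
  by rewrite Fji.2 => /valueN; rewrite opprK [V i j]mxE.
by split=> //; apply/matrixP => i j; rewrite !mxE rmorphN /= conjCK.
Qed.

End FosterForm.

Lemma eq_foster (C : numClosedFieldType) (m s : nat) (omega omega' : 'I_s -> C)
    (Q R0 : 'M[C]_m) (Qj Qj' Rj Rj' : 'I_s -> 'M[C]_m) :
  omega =1 omega' -> Qj =1 Qj' -> Rj =1 Rj' ->
  foster omega Q R0 Qj Rj = foster omega' Q R0 Qj' Rj'.
Proof.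
move=> eo eQ eR; apply/matrixP => i j; rewrite !mxE; congr (_ + _).
by apply: eq_bigr => k _; rewrite eo eQ eR.
Qed.

(** The numerator of the difference has infinitely many roots. *)
Lemma frac_eq_on_nat (C : numClosedFieldType) (f g : {fraction {poly C}}) :
  (forall n : nat, exists2 v, has_value f n.+1%:R v & has_value g n.+1%:R v) ->
  f = g.
Proof.
move=> fg; apply/eqP; rewrite -subr_eq0 [f - g]rat_numden.
suff -> : ratnum (f - g) = 0 by rewrite tofrac0 mul0r.
set p := ratnum _; apply/eqP/negPn/negP => p0.
pose rs : seq C := [seq n.+1%:R | n <- iota 0 (size p)].
have rs_roots : all (root p) rs.
  apply/allP => _ /mapP[n _ ->]; have [v fv gv] := fg n.
  have [] : has_value (f - g) n.+1%:R 0.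
    by rewrite -(subrr v); apply: valueD fv (valueN gv).
  rewrite /is_pole /rateval -/p rootE => q0 /eqP.
  by rewrite mulf_eq0 invr_eq0 (negPf q0) orbF.
have rs_uniq : uniq rs.
  rewrite map_inj_uniq ?iota_uniq // => n1 n2 /eqP.
  by rewrite eqr_nat eqSS => /eqP.
by have := max_poly_roots p0 rs_roots rs_uniq; rewrite size_map size_iota ltnn.
Qed.

(** * Pairing conjugate poles *)

Section PairedResidues.
Variables (C : numClosedFieldType) (m : nat).
Implicit Types (A B Q : 'M[C]_m) (w a z : C).

Definition Remx A : 'M[C]_m := map_mx (fun z => 'Re z) A.
Definition Immx A : 'M[C]_m := map_mx (fun z => 'Im z) A.

Lemma mxpsd_conj A : mxpsd A -> mxpsd (map_mx Num.conj A).
Proof.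
move=> /mxpsdP psdA; apply/mxpsdP => u.
suff -> : qform (map_mx Num.conj A) u = (qform A (map_mx Num.conj u))^*.
  by rewrite conjC_ge0.
rewrite /sesq rmorph_sum /=; apply: eq_bigr => i _.
rewrite rmorph_sum /=; apply: eq_bigr => j _.
by rewrite !mxE !rmorphM /= !conjCK.
Qed.

Lemma mxpsd_scale w A : 0 <= w -> mxpsd A -> mxpsd (w *: A).
Proof.
move=> w0 /mxpsdP psdA; apply/mxpsdP => u.
by rewrite qformZ mulr_ge0.
Qed.

Lemma mxpsdD A B : mxpsd A -> mxpsd B -> mxpsd (A + B).
Proof.
move=> /mxpsdP psdA /mxpsdP psdB; apply/mxpsdP => u.
by rewrite qformD addr_ge0.
Qed.

Lemma RemxE A : Remx A = 2^-1 *: (A + map_mx Num.conj A).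
Proof. by apply/matrixP => i j; rewrite !mxE ReE mulrC. Qed.

Lemma mxpsd_Remx A : mxpsd A -> mxpsd (Remx A).
Proof.
move=> psdA; rewrite RemxE; apply: mxpsd_scale; first by rewrite invr_ge0.
by apply: mxpsdD => //; exact: mxpsd_conj.
Qed.

Lemma Immx_skew A : mxpsd A -> (Immx A)^T = - Immx A.
Proof.
move=> [/hermsymP AE _]; apply/matrixP => i j.
by rewrite !mxE {1}AE !mxE Im_conj.
Qed.

Lemma Immx_scale_skew w A : mxpsd A -> (w *: Immx A)^T = - (w *: Immx A).
Proof. by move=> psdA; rewrite linearZ /= Immx_skew // scalerN. Qed.

(** According to the sign of w, this combination is |w| times A or times its
    conjugate. *)
Lemma mxpsd_pair w A : w \is Num.real -> mxpsd A ->
  mxpsd (`|w| *: Remx A + (w * 'i) *: Immx A).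
Proof.
move=> wr psdA.
have [w0|w0] := real_ge0P wr.
  suff -> : w *: Remx A + (w * 'i) *: Immx A = w *: A by exact: mxpsd_scale.
  by apply/matrixP => i j; rewrite !mxE -mulrA -mulrDr -Crect.
suff -> : (- w) *: Remx A + (w * 'i) *: Immx A = (- w) *: map_mx Num.conj A.
  by apply: mxpsd_scale; [rewrite oppr_ge0 ltW | exact: mxpsd_conj].
apply/matrixP => i j; rewrite !mxE.
rewrite [A i j in RHS]Crect conjC_rect ?Creal_Re ?Creal_Im //; ring.
Qed.

Lemma residue_pair_le w A : w \is Num.real -> mxpsd A ->
  mxle (- (`|w| *: Remx A)) ('i *: (- w *: Immx A)) /\
  mxle ('i *: (- w *: Immx A)) (`|w| *: Remx A).
Proof.
move=> wr psdA; split; rewrite /mxle.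
  have := @mxpsd_pair (- w) A; rewrite rpredN normrN => /(_ wr psdA) psd.
  suff -> : 'i *: (- w *: Immx A) - - (`|w| *: Remx A) =
    `|w| *: Remx A + (- w * 'i) *: Immx A by [].
  by rewrite opprK addrC scalerA mulrC.
suff -> : `|w| *: Remx A - 'i *: (- w *: Immx A) =
  `|w| *: Remx A + (w * 'i) *: Immx A by exact: mxpsd_pair.
by rewrite scalerA mulrN scaleNr opprK mulrC.
Qed.

(** For a = i b, 1 / (t - a) = (t + i b) / (t^2 + b^2). *)
Lemma Re_polar_value (r a t : C) : 'Re a = 0 -> 0 < t ->
  'Re (r / (t - a)) =
  (t ^+ 2 + `|'Im a| ^+ 2)^-1 * (t * 'Re r + - 'Im a * 'Im r).
Proof.
move=> Ra t0; have tr : t \is Num.real by rewrite gtr0_real.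
set b := 'Im a; have br : b \is Num.real by exact: Creal_Im.
have aE : a = 'i * b by rewrite [LHS]Crect Ra add0r.
have i2 := @sqrCi C.
have den0 : t ^+ 2 + b ^+ 2 != 0.
  by rewrite sqrD_sqr_neq0 // (Creal_ReP _ tr) gt_eqF.
have ta : t - a != 0.
  by apply: contraNneq den0 => ta; rewrite -(mulr0 (t + a)) -ta aE; apply/eqP; ring: i2.
have -> : r / (t - a) = (t ^+ 2 + b ^+ 2)^-1 * (r * (t + 'i * b)).
  apply: (mulIf ta); rewrite divfK //; apply: (mulfI den0).
  rewrite !mulrA mulfV // mul1r aE; ring: i2.
rewrite real_normK // ReMl ?rpredV ?rpredD ?rpredX //; congr (_ * _).
rewrite [r in LHS]Crect -/b.
have -> : ('Re r + 'i * 'Im r) * (t + 'i * b) =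
    (t * 'Re r + - b * 'Im r) + 'i * (t * 'Im r + b * 'Re r) by ring: i2.
by rewrite Re_rect ?rpredD ?rpredM ?rpredN ?Creal_Re ?Creal_Im.
Qed.

Section Expansion.
Variables (F : 'M[{fraction {poly C}}]_m) (s : seq C) (Q B : 'M[C]_m) (A : C -> 'M[C]_m).
Hypothesis s_imag : forall a, a \in s -> 'Re a = 0.
Hypothesis FE : forall i j, F i j = constf (Q i j) * ('X)%:F + constf (B i j)
                          + \sum_(a <- s) polar (A a i j) a.

Lemma expansion_value z i j : 'Re z != 0 -> has_value (F i j) z
  (Q i j * z + B i j + \sum_(a <- s) A a i j / (z - a)).
Proof.
move=> Rz; rewrite FE; apply: valueD.
  apply: valueD; last exact: value_const.
  apply: valueM; first exact: value_const.
  by have := value_poly 'X z; rewrite hornerX.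
rewrite !big_seq; apply: value_sum => a /s_imag Ra.
by apply: polar_value; apply: contraNneq Rz => ->; rewrite Ra.
Qed.

(** At a positive real t, the value of F is real, hence equal to the real part of
    its expansion, which is computed term by term. *)
Lemma expansion_foster :
    (forall t, 0 < t -> mxeval F t \is a realmx) ->
  F = foster (fun k : 'I_(size s) => `|'Im s`_k|) (Remx Q) (Remx B)
        (fun k => Remx (A s`_k)) (fun k => - 'Im s`_k *: Immx (A s`_k)).
Proof.
move=> F_real; apply/matrixP => i j; apply: frac_eq_on_nat => n.
set t : C := n.+1%:R; have t0 : 0 < t by rewrite ltr0Sn.
have tr : t \is Num.real by rewrite gtr0_real.
have Rt : 'Re t != 0 by rewrite (Creal_ReP _ tr) gt_eqF.
have Fv := expansion_value i j Rt.
set G := foster _ _ _ _ _.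
have [Gv GvE] : has_value (G i j) t ('Re (mxeval F t i j)).
  have := foster_value (Remx Q) (Remx B) (fun k : 'I_(size s) => Remx (A s`_k))
    (fun k => - 'Im s`_k *: Immx (A s`_k)) (fun k => normr_ge0 ('Im s`_k)) Rt i j.
  congr has_value; rewrite [mxeval F t i j]mxE Fv.2 !mxE !raddfD /= ReMr // mulrC.
  congr (_ + _); rewrite summxE raddf_sum /= (big_nth 0) big_mkord.
  apply: eq_bigr => k _; rewrite !mxE Re_polar_value //.
  by apply: s_imag; rewrite mem_nth.
exists (mxeval F t i j); first by rewrite mxE; split=> //; exact: Fv.1.
by split=> //; rewrite GvE; apply/Creal_ReP/mxOverP/F_real.
Qed.

(** Oddness at the point 1 suffices: the contributions of Q and of the polar parts to
    both sides cancel because these matrices are Hermitian and the poles imaginary. *)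
Lemma expansion_skew : mxpsd Q -> (forall a, a \in s -> mxpsd (A a)) ->
    - mxeval F 1 = ((mxeval F (- 1)) ^t*)%sesqui ->
  (Remx B)^T = - Remx B.
Proof.
move=> [/hermsymP QE _] psdA /matrixP odd.
suff BE i j : B i j = - (B j i)^*.
  by apply/matrixP => i j; rewrite !mxE BE raddfN /= Re_conj.
have R1 : 'Re (1 : C) != 0 by rewrite (Creal_ReP _ (rpred1 _)) oner_neq0.
have RN1 : 'Re (- 1 : C) != 0 by rewrite raddfN /= oppr_eq0.
have := odd i j; rewrite !mxE (expansion_value i j R1).2 (expansion_value j i RN1).2.
rewrite !rmorphD rmorphM rmorphN1 /= rmorph_sum /=.
have -> : (Q j i)^* = Q i j by rewrite [in RHS]QE !mxE.
have -> : \sum_(a <- s) (A a j i / (- 1 - a))^* = - \sum_(a <- s) A a i j / (1 - a).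
  rewrite -sumrN !big_seq; apply: eq_bigr => a a_s.
  have aJ : a^* = - a.
    by rewrite [a in RHS]Crect [a in LHS]Crect (s_imag a_s) !add0r rmorphM /= conjCi
       (CrealP (Creal_Im a)) mulNr.
  have [/hermsymP AE _] := psdA a a_s.
  have -> : A a i j = (A a j i)^* by rewrite [in LHS]AE !mxE.
  rewrite fmorph_div /= rmorphB rmorphN1 /= aJ opprK.
  by rewrite (_ : - 1 + a = - (1 - a)) ?invrN ?mulrN // opprB addrC.
rewrite !mulrN1 mulr1 => E.
have := congr1 (fun x => x + (Q i j + \sum_(a <- s) A a i j / (1 - a))) E.
set S := \sum_(a <- s) _; set q := Q i j; set b := B i j; set b' := (B j i)^*.
have -> : - (q + b + S) + (q + S) = - b by ring.
have -> : - q + b' - S + (q + S) = b' by ring.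
by move=> <-; rewrite opprK.
Qed.

End Expansion.
End PairedResidues.

(** * Positive real odd matrix functions *)

Section PositiveRealOdd.
Variables (R : realType) (m : nat).
Implicit Types (A : 'M[R]_m) (B : 'M[R[i]]_m) (F : 'M[{fraction {poly R[i]}}]_m).

Lemma cplxmx_real A : cplxmx A \is a realmx.
Proof. by apply/mxOverP => i j; rewrite mxE complex_real. Qed.

Lemma cplxmx_skew A : A^T = - A -> (cplxmx A)^T = - cplxmx A.
Proof. by move=> AT; rewrite /cplxmx map_trmx AT map_mxN. Qed.

Lemma foster_PRO s (omega : 'I_s -> R[i]) (Q R0 : 'M[R]_m) (Qj Rj : 'I_s -> 'M[R]_m) :
    (forall j, 0 <= omega j) ->
    mxpsd (cplxmx Q) -> R0^T = - R0 ->
    (forall j, mxpsd (cplxmx (Qj j))) -> (forall j, (Rj j)^T = - Rj j) ->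
    (forall j, mxle (- (omega j *: cplxmx (Qj j))) ('i *: cplxmx (Rj j))) ->
    (forall j, mxle ('i *: cplxmx (Rj j)) (omega j *: cplxmx (Qj j))) ->
  PRO (foster omega (cplxmx Q) (cplxmx R0)
              (fun j => cplxmx (Qj j)) (fun j => cplxmx (Rj j))).
Proof.
move=> om0 psdQ skewR0 psdQj skewRj Rj_ge Rj_le.
have real A := cplxmx_real A.
exact: (foster_PRO_axioms om0 (real Q) (real R0) (fun j => real (Qj j))
  (fun j => real (Rj j)) psdQ (cplxmx_skew skewR0) psdQj
  (fun j => cplxmx_skew (skewRj j)) Rj_ge Rj_le).
Qed.

Lemma matrix_foster s (omega : 'I_s -> R) (Q R0 : 'M[R]_m) (Qj Rj : 'I_s -> 'M[R]_m) :
  ratX R *: ratmx Q + ratmx R0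
    + \sum_(j < s) (ratX R ^+ 2 + ratC ((omega j)%:C%C ^+ 2))^-1
                *: (ratX R *: ratmx (Qj j) + ratmx (Rj j)) =
  foster (fun j => (omega j)%:C%C) (cplxmx Q) (cplxmx R0)
              (fun j => cplxmx (Qj j)) (fun j => cplxmx (Rj j)).
Proof.
apply/matrixP => i j; rewrite !mxE summxE; congr (_ + _).
by apply: eq_bigr => k _; rewrite !mxE.
Qed.

(** Positivity excludes the right half-plane and oddness reflects this to the left. *)
Lemma PRO_poles F : PRO F -> forall z, is_mxpole F z -> 'Re z = 0.
Proof.
move=> [pos _ odd] z Fz; have Rz := @Creal_Re _ z.
have [Rz0|Rz0|//] := real_ltgtP Rz (real0 _).
  have [] := pos (- z^*).
    by rewrite raddfN /= Re_conj oppr_gt0.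
  by move=> /odd[]; rewrite rmorphN /= conjCK opprK Fz.
by have [] := pos z Rz0; rewrite Fz.
Qed.

Lemma cplxmx_Re B : cplxmx (map_mx (@complex.Re R) B) = Remx B.
Proof. by apply/matrixP => i j; rewrite !mxE complexRe. Qed.

Lemma cplxmx_Im B : cplxmx (map_mx (@complex.Im R) B) = Immx B.
Proof. by apply/matrixP => i j; rewrite !mxE complexIm. Qed.

Lemma cplxmx_inj : injective (@cplxmx R m).
Proof.
by move=> A1 A2 /matrixP E; apply/matrixP => i j; have := E i j; rewrite !mxE => /complexI.
Qed.

Lemma cplxmx_skewI A : (cplxmx A)^T = - cplxmx A -> A^T = - A.
Proof.
by move=> E; apply: cplxmx_inj; rewrite /cplxmx map_mxN -map_trmx.
Qed.

End PositiveRealOdd.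

Theorem theorem4p1 (R : realType) (m : nat)
    (F : 'M[{fraction {poly R[i]}}]_m) :
  PRO F <->
  exists (s : nat) (omega : 'I_s -> R) (Q R0 : 'M[R]_m)
         (Qj Rj : 'I_s -> 'M[R]_m),
    [/\ mxpsd (cplxmx Q),
        R0^T = - R0,
        (forall j, [/\ 0 <= omega j, mxpsd (cplxmx (Qj j)) & (Rj j)^T = - Rj j]),
        (forall j,
           mxle (- ((omega j)%:C%C *: cplxmx (Qj j))) ('i *: cplxmx (Rj j)) /\
           mxle ('i *: cplxmx (Rj j)) ((omega j)%:C%C *: cplxmx (Qj j)))
      & F = ratX R *: ratmx Q + ratmx R0
            + \sum_(j < s) (ratX R ^+ 2 + ratC ((omega j)%:C%C ^+ 2))^-1
                *: (ratX R *: ratmx (Qj j) + ratmx (Rj j))].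
Proof.
split=> [PRO_F|[s [omega [Q [R0 [Qj [Rj [psdQ skewR0 pairs ineqs ->]]]]]]]]; last first.
  have omega_ge0 j : 0 <= (omega j)%:C%C by rewrite ler0c; case: (pairs j).
  have psdQj j : mxpsd (cplxmx (Qj j)) by case: (pairs j).
  have skewRj j : (Rj j)^T = - Rj j by case: (pairs j).
  rewrite matrix_foster.
  exact: (foster_PRO omega_ge0 psdQ skewR0 psdQj skewRj
            (fun j => (ineqs j).1) (fun j => (ineqs j).2)).
have imag := PRO_poles PRO_F; have [pos real odd] := PRO_F.
have [s [Q [B [psdQ s_imag psdA FE]]]] := positive_mxfun_expansion pos imag.
have Re_gt0 (t : R[i]) : 0 < t -> 0 < 'Re t.
  by move=> t0; rewrite (Creal_ReP _ (gtr0_real t0)).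
have F_real (t : R[i]) : 0 < t -> mxeval F t \is a realmx.
  by move=> t0; apply: real; [exact: gtr0_real | exact: (pos t (Re_gt0 t t0)).1].
pose a (k : 'I_(size s)) := s`_k.
have a_s k : a k \in s by rewrite mem_nth.
pose w k := complex.Im (a k).
have wE k : (w k)%:C%C = 'Im (a k) by rewrite complexIm.
have absE k : (`|w k|)%:C%C = `|'Im (a k)| by rewrite -wE normc_def /= expr0n addr0 sqrtr_sqr.
pose Qj k := map_mx (@complex.Re R) (mxresidue F (a k)).
pose Rj k := - w k *: map_mx (@complex.Im R) (mxresidue F (a k)).
have RjE k : cplxmx (Rj k) = - 'Im (a k) *: Immx (mxresidue F (a k)).
  by rewrite -cplxmx_Im -wE -rmorphN /cplxmx map_mxZ.
have QjE k : cplxmx (Qj k) = Remx (mxresidue F (a k)) by exact: cplxmx_Re.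
exists (size s), (fun k => `|w k|), (map_mx (@complex.Re R) Q), (map_mx (@complex.Re R) B), Qj, Rj.
split.
- by rewrite cplxmx_Re; exact: mxpsd_Remx.
- apply: cplxmx_skewI; rewrite cplxmx_Re.
  apply: (expansion_skew s_imag FE psdQ psdA).
  have [F1 _] := pos 1 (Re_gt0 1 ltr01).
  by have [_] := odd 1 F1; rewrite rmorph1.
- move=> k; split; first exact: normr_ge0.
    by rewrite QjE; apply: mxpsd_Remx; exact: psdA.
  by apply: cplxmx_skewI; rewrite RjE; apply: Immx_scale_skew; exact: psdA.
- move=> k; rewrite absE QjE RjE; apply: residue_pair_le; first exact: Creal_Im.
  exact: psdA.
rewrite matrix_foster (expansion_foster s_imag FE F_real) !cplxmx_Re.
by apply: eq_foster => k; [rewrite absE | rewrite QjE | rewrite RjE].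
Qed.
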